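(* Let $g\in G(N)$ be a network with a constellation component $C$ that has depth $\ell\ge 1$ and contains more than $k$ receivers. Let $M$ be the set of centers of $C$. Suppose that $|N\setminus C|\ge\max\{\ell,|M|\}+1$. Then there exists an extension $g^+$ of $g$ that strictly benefits the sender, i.e. $\operatorname{Val}_k(g^+)>\operatorname{Val}_k(g)$. Moreover, the sender's value for this extension is $\operatorname{Val}_k(g^+)=V_k^n$.
   Context: **Persuasion model.** $N=\{1,\dots,n\}$ is the set of receivers, $\Omega=\{X,Y\}$ the set of states, $\lambda^0$ a common prior on $\Omega$ with $\lambda^0(X),\lambda^0(Y)>0$. The critical mass $k$ is an integer with $\lfloor\frac{n+1}{2}\rfloor\le k\le n$, and $\lambda^0(X)<\frac{k}{n+k}$. All receivers have the same countably infinite message set $S_i$ (containing $x,y$); $S=\prod_{i\in N}S_i$ is the set of signals. An experiment is a map $\pi:\Omega\to\Delta(S)$, where $\Delta(S)$ is the set of finitely supported probability distributions on $S$; $\Pi$ is the set of all experiments; $S^\pi=\{s\in S:\exists\omega\in\Omega,\ \pi(s|\omega)>0\}$. A network $g$ on $N$ is an undirected graph, $g_{ij}=g_{ji}\in\{0,1\}$; $G(N)$ is the set of all networks on $N$; $g_0$ is the empty network. The neighborhood is $N_i(g)=\{j: g_{ij}=1\}\cup\{i\}$. A component is a connected component (identified with its set of receivers when convenient). A network $g^+\in G(N)$ is an extension of $g$ (written $g\subsetneq g^+$) if it is obtained from $g$ by adding one or more links (same set of receivers). Receiver $i$ observes $s_i(g)=(s_j)_{j\in N_i(g)}$. For $s\in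 S^\pi$ let $A_i^\pi(g,s)=\{t\in S^\pi: t_i(g)=s_i(g)\}$ and let the posterior be $$\lambda_i^{s,g}(\omega)=\frac{\sum_{t\in A_i^\pi(g,s)}\pi(t|\omega)\lambda^0(\omega)}{\sum_{\omega'\in\Omega}\sum_{t\in A_i^\pi(g,s)}\pi(t|\omega')\lambda^0(\omega')}.$$ Receiver $i$ takes action $x$ if $\lambda_i^{s,g}(X)\ge\frac12$ and action $y$ otherwise. The outcome is $x$ if at least $k$ receivers take action $x$, and $y$ otherwise. The value $V_k^\pi(g)$ of $\pi$ on $g$ is the (unconditional, under $\lambda^0$ and $\pi$) probability that the outcome is $x$. The value of the network is $\operatorname{Val}_k(g)=\sup_{\pi\in\Pi}V_k^\pi(g)$. $V_k^n:=\operatorname{Val}_k(g_0)$ is the value of the empty network on $n$ receivers; under the assumption $\lambda^0(X)<\frac{k}{n+k}$ it is known that $V_k^n=\frac{n+k}{k}\lambda^0(X)<1$. **Stellar networks.** A stellar network is a network that either (i) consists of a single node; or (ii) contains a node $r$ (the root) connected to all other nodes, such that the other nodes are partitioned into at least two disjoint nonempty subsets, each of which (with the induced links) is itself a stellar network, and no edges connect nodes in different partition elements. A stellar network has an associated directed rooted tree: the root is $r$, its children are the roots of the stellar networks on the partition elements, and so on recursively (a single-node network is its own root). The depth of a stellar network is the length of the longest directed path in this tree. **Constellations.** A constellation is a network $h$ on a node set $D$ together with a nonempty set of centers $M\subsetneq D$ such that for all $i\in M$: $i$ is connected to all other nodes of $D$ (degree $|D|-1$), and the subnetwork $h_M^i$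 of $h$ induced on $(D\setminus M)\cup\{i\}$ is a stellar network. The depth of the constellation is the maximum over $i\in M$ of the depth of the stellar network $h_M^i$. A constellation component of $g$ is a component that is a constellation. *)

(* Defs.v *)
(* MathComp comes last, so that [set0], [partition], [trivIset], ... are those
   of finset. *)
From mathcomp Require Export boolp classical_sets cardinality reals.
From mathcomp Require Export finmap.
From mathcomp Require Export all_boot all_order all_algebra.

Set Implicit Arguments.
Unset Strict Implicit.
Unset Printing Implicit Defensive.

Import Order.TTheory GRing.Theory Num.Theory.
Local Open Scope ring_scope.

Record network (n : nat) := Network {
  link :> rel 'I_n;
  link_sym : symmetric link;
  link_irr : irreflexive link }.

Definition empty_network (n : nat) : network n :=
  @Network n (fun _ _ => false) (fun _ _ => erefl) (fun _ => erefl).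

Definition neighborhood (n : nat) (g : network n) (i : 'I_n) : {set 'I_n} :=
  [set j | g i j] :|: [set i].

Definition is_component (n : nat) (g : network n) (C : {set 'I_n}) : Prop :=
  exists i : 'I_n, C = [set j | connect g i j].

Definition is_extension (n : nat) (g gp : network n) : Prop :=
  (forall i j, g i j -> gp i j) /\ (exists i j, gp i j && ~~ g i j).

(* [stellar e D r A]: the subgraph of [e] induced on [D] is a stellar network
   with root [r], and [A] is the set of arcs (parent, child) of its associated
   directed rooted tree.  In the second case [rt B] and [A B] are the root and
   the arcs of the block [B].  Given [D], both [r] and [A] are unique: a node
   other than [r] has no link to the other blocks, and the blocks, being
   connected, are the connected components of [D :\ r]. *)
Inductive stellar (T : finType) (e : rel T) :
    {set T} -> T -> {set T * T} -> Prop :=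
| StellarNode (r : T) : stellar e [set r] r set0
| StellarRoot (D : {set T}) (r : T) (P : {set {set T}})
    (rt : {set T} -> T) (A : {set T} -> {set T * T}) :
    r \in D ->
    (forall v, v \in D :\ r -> e r v) ->
    partition P (D :\ r) ->
    (2 <= #|P|)%N ->
    (forall B, B \in P -> stellar e B (rt B) (A B)) ->
    (forall B B', B \in P -> B' \in P -> B != B' ->
       forall u v, u \in B -> v \in B' -> ~~ e u v) ->
    stellar e D r ([set (r, rt B) | B in P] :|: \bigcup_(B in P) A B).

Definition is_stellar (T : finType) (e : rel T) (D : {set T}) : Prop :=
  exists r A, stellar e D r A.

(* Length (number of arcs) of a longest directed path; the bound [l < #|T|]
   is harmless since the arcs of a rooted tree form no directed cycle. *)
Definition longest_path (T : finType) (A : {set T * T}) : nat :=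
  \max_(l < #|T| | [exists u : T, [exists p : l.-tuple T,
     path (fun a b => (a, b) \in A) u p]]) l.

Definition stellar_depth (T : finType) (e : rel T) (D : {set T}) (d : nat) :
    Prop :=
  exists r A, stellar e D r A /\ longest_path A = d.

Definition is_constellation (T : finType) (e : rel T) (D M : {set T}) : Prop :=
  [/\ M != set0, M \proper D,
      (forall i j, i \in M -> j \in D -> j != i -> e i j)
    & (forall i, i \in M -> is_stellar e ((D :\: M) :|: [set i]))].

Definition constellation_depth (T : finType) (e : rel T) (D M : {set T})
    (l : nat) : Prop :=
  exists d : T -> nat,
    (forall i, i \in M -> stellar_depth e ((D :\: M) :|: [set i]) (d i)) /\
    l = \max_(i in M) d i.

Definition state : finType := bool.
Definition stX : state := true.
Definition stY : state := false.

Definition signal (n : nat) (Msg : countType) : countType := {ffun 'I_n -> Msg}.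

Record experiment (R : realType) (n : nat) (Msg : countType) := Experiment {
  prob :> state -> {fsfun signal n Msg -> R with 0};
  prob_ge0 : forall w s, 0 <= prob w s;
  prob_sum1 : forall w, \sum_(s <- finsupp (prob w)) prob w s = 1 }.

Section Persuasion.
Local Open Scope fset_scope.

Variables (R : realType) (n : nat) (Msg : countType).
(* [x] and [y] are the two actions, which are also messages. *)
Variables (x y : Msg) (lam0 : state -> R) (k : nat).

Implicit Types (pi : experiment R n Msg) (g : network n) (s t : signal n Msg).

Definition signals_of pi : {fset signal n Msg} :=
  finsupp (pi stX) `|` finsupp (pi stY).

Definition info_set pi g (i : 'I_n) s : {fset signal n Msg} :=
  [fset t in signals_of pi | [forall j in neighborhood g i, t j == s j]].

Definition posterior pi g i s (w : state) : R :=
  (\sum_(t <- info_set pi g i s) pi w t * lam0 w) /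
  (\sum_(w' : state) \sum_(t <- info_set pi g i s) pi w' t * lam0 w').

Definition action pi g s (i : 'I_n) : Msg :=
  if 2^-1 <= posterior pi g i s stX then x else y.

Definition outcome pi g s : Msg :=
  if (k <= #|[set i | action pi g s i == x]|)%N then x else y.

Definition exp_value pi g : R :=
  \sum_(w : state)
    lam0 w * \sum_(s <- finsupp (pi w) | outcome pi g s == x) pi w s.

(* The supremum is over a nonempty set contained in [0, 1]. *)
Definition net_value g : R :=
  sup [set exp_value pi g | pi in [set: experiment R n Msg]]%classic.

Definition empty_value : R := net_value (empty_network n).

End Persuasion.

(* Main.v *)
(* Call a network domination-free if no closed neighborhood contains another.

   On every network, a receiver who plays x is at least as likely to be in
   state X as in state Y, so k P(Y, outcome x) <= n lam0(X), and the value is at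
   most lam0(X) (1 + n/k).  A center of C sees everything that any receiver of
   C sees, so the x-decisions in C nearly coincide and more than k receivers
   tend to play x together; this improves n to n - 1 in the bound for g.

   A domination-free network attains the general bound by secret sharing: each
   receiver j has a random secret bit vector, distributed over the nodes of her
   neighborhood, and her parity tells her whether to play x.  No other receiver
   sees all the shares of j, so an even parity is the same news in both states.
   In state X all parities are even; in state Y either exactly k of them,
   uniformly chosen, or none.

   To extend g to a domination-free network, make the complement O of C a
   clique and link every node of C to a set of nodes of O ("colors").  The
   nodes of C that are not centers have a proper coloring with q <= l colors.  If
   |M| + q <= |O|, then C has a proper coloring using all the colors of O, and
   one link per node is enough.  Otherwise color 0 is kept as an extra mark that
   separates the other nodes from the centers whose color they may share. *)

Require Import Defs.
From mathcomp Require Import functions lra ring zify.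
Import Order.TTheory GRing.Theory Num.Theory.
Local Open Scope ring_scope.

Set Implicit Arguments.
Unset Strict Implicit.
Unset Printing Implicit Defensive.

(** * Upper bounds on the value *)

(** The inequality is summed over the fibres of [f] that make up [P]. A fibre is indexed by the set
    of its elements, since [V] need not be finite. *)
Lemma sum_classes_le (R : realType) (T : finType) (V : eqType) (f : T -> V)
    (a b : T -> R) (P : pred T) :
    (forall s t, f s = f t -> P s = P t) ->
    (forall s, P s -> \sum_(t | f t == f s) b t <= \sum_(t | f t == f s) a t) ->
  \sum_(t | P t) b t <= \sum_(t | P t) a t.
Proof.
move=> Pf le_ba; pose cls t := [set u | f u == f t].
rewrite [leLHS](partition_big cls predT) // [leRHS](partition_big cls predT) //.
apply: ler_sum => A _.
case: (pickP (fun t => P t && (cls t == A))) => [t /andP[Pt /eqP tA]|none]; last first.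
  by rewrite !big_pred0.
have E s : P s && (cls s == A) = (f s == f t).
  rewrite -tA; apply/andP/eqP => [[_ /eqP/setP/(_ s)]|fst].
    by rewrite !inE eqxx => /esym/eqP.
  by split; [rewrite (Pf _ _ fst)|apply/eqP/setP => u; rewrite !inE fst].
by rewrite !(eq_bigl _ _ E); apply: le_ba.
Qed.

Section Masses.

Variables (R : realType) (n : nat) (Msg : countType).
Variables (x y : Msg) (lam0 : state -> R) (k : nat).
Hypotheses (xy : x != y) (lam0_gt0 : forall w, 0 < lam0 w).
Implicit Types (pi : experiment R n Msg) (g : network n).

(** A joint, not a conditional, probability. Both states are summed over the same [signals_of pi],
    so that their masses can be compared class by class. *)
Definition mass pi w (P : pred (signal n Msg)) : R :=
  \sum_(s <- signals_of pi | P s) lam0 w * pi w s.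

Definition agree g (i : 'I_n) (s t : signal n Msg) : bool :=
  [forall j in neighborhood g i, t j == s j].

Definition acts_x pi g (i : 'I_n) (s : signal n Msg) : bool :=
  action x y lam0 pi g s i == x.

Definition num_x pi g (s : signal n Msg) : nat := #|[set i | acts_x pi g i s]|.

(** A label whose equality expresses [agree], which turns information sets into fibres. *)
Definition view g (i : 'I_n) (s : signal n Msg) : {ffun 'I_n -> option Msg} :=
  [ffun j => if j \in neighborhood g i then Some (s j) else None].

Lemma view_eq g i s t : (view g i t == view g i s) = agree g i s t.
Proof.
apply/eqP/forall_inP => [/ffunP E j jN|E].
  by move/eqP: (E j); rewrite !ffunE jN.
by apply/ffunP=> j; rewrite !ffunE; case: ifP => // /E/eqP ->.
Qed.

Lemma agreexx g i s : agree g i s s.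
Proof. by apply/forall_inP. Qed.

Lemma mass_ge0 pi w P : 0 <= mass pi w P.
Proof.
by apply: sumr_ge0 => s _; rewrite mulr_ge0 ?prob_ge0 // ltW.
Qed.

Lemma finsupp_signals pi w : (finsupp (pi w) `<=` signals_of pi)%fset.
Proof. by case: w; rewrite ?fsubsetUl ?fsubsetUr. Qed.

Lemma massE pi w (P : pred (signal n Msg)) :
  mass pi w P = lam0 w * \sum_(s <- finsupp (pi w) | P s) pi w s.
Proof.
rewrite mulr_sumr /mass big_mkcond [RHS]big_mkcond /=.
rewrite [RHS](big_fset_incl _ (finsupp_signals pi w)) // => s _ /fsfun_dflt ->.
by rewrite mulr0 if_same.
Qed.

Lemma mass_predT pi w : mass pi w predT = lam0 w.
Proof. by rewrite massE prob_sum1 mulr1. Qed.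

Lemma mass_split pi w (Q P : pred (signal n Msg)) :
  mass pi w P = mass pi w (fun s => P s && Q s) + mass pi w (fun s => P s && ~~ Q s).
Proof. exact: bigID. Qed.

Lemma eq_mass pi w (P Q : pred (signal n Msg)) : P =1 Q -> mass pi w P = mass pi w Q.
Proof. by move=> PQ; apply: eq_bigl. Qed.

Lemma mass_le pi w (P Q : pred (signal n Msg)) :
  (forall s, P s -> Q s) -> mass pi w P <= mass pi w Q.
Proof.
move=> PQ; rewrite (mass_split pi w P Q) [leLHS](@eq_mass _ _ _ (fun s => Q s && P s)).
  by rewrite lerDl mass_ge0.
by move=> s /=; case: (boolP (P s)) => [/PQ ->|]; rewrite ?andbF.
Qed.

Lemma info_set_mass pi g i s w :
  \sum_(t <- info_set pi g i s) pi w t * lam0 w = mass pi w (agree g i s).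
Proof.
rewrite /info_set big_fset /=.
by apply: eq_big => t; rewrite ?andbT // mulrC.
Qed.

Lemma mass_gt0 pi (P : pred (signal n Msg)) s :
  s \in signals_of pi -> P s -> 0 < mass pi stX P + mass pi stY P.
Proof.
move=> sS Ps.
have [w wgt0] : exists w, 0 < pi w s.
  move: sS; rewrite in_fsetU => /orP[]; rewrite mem_finsupp => sn0;
    by [exists stX; rewrite lt0r sn0 prob_ge0|exists stY; rewrite lt0r sn0 prob_ge0].
have mgt0 : 0 < mass pi w P.
  rewrite /mass (big_rem s) //= Ps ltr_wpDr ?mulr_gt0 //.
  by apply: sumr_ge0 => t _; rewrite mulr_ge0 ?prob_ge0 // ltW.
by case: w mgt0 {wgt0} => ?; [rewrite ltr_wpDr ?mass_ge0|rewrite ltr_wpDl ?mass_ge0].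
Qed.

Lemma acts_xE pi g i s : s \in signals_of pi ->
  acts_x pi g i s = (mass pi stY (agree g i s) <= mass pi stX (agree g i s)).
Proof.
move=> sS; rewrite /acts_x /action /posterior big_bool !info_set_mass.
have := mass_gt0 sS (agreexx g i s); rewrite -/stX -/stY.
set X := mass _ _ _; set Y := mass _ _ _ => XY.
rewrite ler_pdivlMr // mulrDr; case: ifP => [|/negbT]; rewrite ?eqxx 1?eq_sym ?(negbTE xy); lra.
Qed.

Lemma eq_acts_x pi g i s t : agree g i s t -> acts_x pi g i s = acts_x pi g i t.
Proof.
rewrite -view_eq => /eqP E.
have A : agree g i s =1 agree g i t by move=> u; rewrite -!view_eq E.
have I w : \sum_(u <- info_set pi g i s) pi w u * lam0 w =
           \sum_(u <- info_set pi g i t) pi w u * lam0 w.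
  by rewrite !info_set_mass; apply: eq_mass.
rewrite /acts_x /action /posterior I; congr (_ == _).
by rewrite [X in _ / X](eq_bigr _ (fun w _ => I w)).
Qed.

(** [P] is a union of information sets of [i], and on each of them acting x means that state Y has
    at most the mass of state X. *)
Lemma mass_acts_x_le pi g i (P : pred (signal n Msg)) :
    (forall s t, agree g i s t -> P s = P t) ->
    (forall s, P s -> acts_x pi g i s) ->
  mass pi stY P <= mass pi stX P.
Proof.
move=> Pi Px; rewrite /mass !big_seq_fsetE /=.
apply: (@sum_classes_le R _ _ (fun s : signals_of pi => view g i (val s))).
  by move=> s t /eqP E; apply: Pi; rewrite -view_eq eq_sym.
move=> s /Px; rewrite acts_xE ?(valP s) // /mass !big_seq_fsetE /=.
by rewrite !(eq_bigl _ _ (fun t => view_eq g i (val s) (val t))).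
Qed.

Lemma sum_mass_acts_x pi g w :
  \sum_i mass pi w (acts_x pi g i) =
  \sum_(s <- signals_of pi) (num_x pi g s)%:R * (lam0 w * pi w s).
Proof.
under eq_bigr do rewrite /mass big_mkcond.
rewrite exchange_big /=; apply: eq_bigr => s _.
rewrite -big_mkcond sumr_const mulr_natl; congr (_ *+ _).
by apply: eq_card => i; rewrite inE.
Qed.

Lemma outcomeE pi g s : (outcome x y lam0 k pi g s == x) = (k <= num_x pi g s)%N.
Proof. by rewrite /outcome; case: ifP => // _; rewrite ?eqxx // eq_sym (negbTE xy). Qed.

Lemma exp_valueE pi g :
  exp_value x y lam0 k pi g =
  mass pi stX (fun s => (k <= num_x pi g s)%N) + mass pi stY (fun s => (k <= num_x pi g s)%N).
Proof.
rewrite /exp_value big_bool !massE; congr (_ * _ + _ * _);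
  by apply: eq_bigl => s; rewrite outcomeE.
Qed.

(** The x-players are counted signal by signal: at least [k] under outcome x, and at least one more
    where [k] is exceeded. *)
Lemma mass_outcome_le pi g :
  k%:R * mass pi stY (fun s => (k <= num_x pi g s)%N)
    + mass pi stY (fun s => (k < num_x pi g s)%N)
  <= \sum_i mass pi stY (acts_x pi g i).
Proof.
rewrite sum_mass_acts_x /mass mulr_sumr big_mkcond [X in _ + X]big_mkcond -big_split /=.
rewrite big_seq [leRHS]big_seq; apply: ler_sum => s _.
set p := lam0 _ * _; have p0 : 0 <= p by rewrite mulr_ge0 ?prob_ge0 // ltW.
case: ifP => kn; case: ifP => kn'; rewrite ?addr0 ?add0r.
- by rewrite -[X in _ + X]mul1r -mulrDl ler_wpM2r // natr1 ler_nat.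
- by rewrite ler_wpM2r // ler_nat.
- by rewrite (ltnW kn') in kn.
- exact: mulr_ge0.
Qed.

Lemma mass_outcome_upper pi g :
  k%:R * mass pi stY (fun s => (k <= num_x pi g s)%N) <= n%:R * lam0 stX.
Proof.
have := mass_outcome_le pi g; have := mass_ge0 pi stY (fun s => (k < num_x pi g s)%N).
have : \sum_i mass pi stY (acts_x pi g i) <= \sum_(i < n) lam0 stX.
  apply: ler_sum => i _; rewrite -(mass_predT pi).
  apply: le_trans (@mass_acts_x_le pi g i _ _ _) (mass_le _ _ _) => // s t; exact: eq_acts_x.
rewrite sumr_const card_ord -mulr_natl; lra.
Qed.

(* When c plays x in state Y, either more than k receivers do, or c overrules
   some less informed w in C; by [mass_acts_x_le] for c, the mass of the latter
   event is at most what w loses by not playing x in state X. *)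
Lemma mass_outcome_center pi g (C : {set 'I_n}) (c : 'I_n) :
    (k < #|C|)%N ->
    (forall w, w \in C -> neighborhood g w \subset neighborhood g c) ->
  k%:R * mass pi stY (fun s => (k <= num_x pi g s)%N) <= (n%:R - 1) * lam0 stX.
Proof.
move=> Ck Cc.
pose loss w := mass pi stX (fun s => ~~ acts_x pi g w s).
have agree_sub w s t : w \in C -> agree g c s t -> agree g w s t.
  by move=> /Cc /subsetP wc /forall_inP st; apply/forall_inP => j /wc /st.
have split w : mass pi stX (acts_x pi g w) = lam0 stX - loss w.
  rewrite -(mass_predT pi) (mass_split pi stX (acts_x pi g w) predT) addrK.
  exact: eq_mass.
have Yi i : mass pi stY (acts_x pi g i) <= lam0 stX - loss i.
  by rewrite -split; apply: (@mass_acts_x_le pi g i) => // s t; apply: eq_acts_x.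
have defect w : w \in C ->
    mass pi stY (fun s => acts_x pi g c s && ~~ acts_x pi g w s) <= loss w.
  move=> wC; apply: le_trans (@mass_acts_x_le pi g c _ _ _) (mass_le _ _ _).
  - by move=> s t st; rewrite (eq_acts_x pi st) (eq_acts_x pi (agree_sub _ _ _ wC st)).
  - by move=> s /andP[].
  - by move=> s /andP[].
have cle : mass pi stY (acts_x pi g c) <=
    mass pi stY (fun s => (k < num_x pi g s)%N) + \sum_(w in C | w != c) loss w.
  rewrite (mass_split pi stY (fun s => (k < num_x pi g s)%N)) lerD //.
    by apply: mass_le => s /andP[].
  apply: (@le_trans _ _ (\sum_(w in C | w != c)
     mass pi stY (fun s => acts_x pi g c s && ~~ acts_x pi g w s))); last first.
    by apply: ler_sum => w /andP[/defect].
  rewrite /mass (exchange_big_dep predT) //= big_mkcond.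
  apply: ler_sum => s _; rewrite sumr_const -mulr_natl.
  set p := lam0 _ * _; have p0 : 0 <= p by rewrite mulr_ge0 ?prob_ge0 // ltW.
  case: ifP => [/andP[cx]|_]; last by rewrite mulr_ge0.
  rewrite -leqNgt => num_le; rewrite -[leLHS]mul1r ler_wpM2r // ler1n.
  (* At most [k] receivers play x, too few to include all of [C]. *)
  have /subsetPn[w wC wx] : ~~ (C \subset [set i | acts_x pi g i s]).
    by apply/negP => /subset_leq_card; rewrite leqNgt (leq_ltn_trans num_le).
  rewrite inE in wx; apply/card_gt0P; exists w; rewrite unfold_in wC cx wx !andbT /=.
  by apply: contraNneq wx => ->.
have rest : \sum_(i | i != c) mass pi stY (acts_x pi g i) <=
    (n%:R - 1) * lam0 stX - \sum_(w in C | w != c) loss w.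
  apply: (@le_trans _ _ (\sum_(i | i != c) (lam0 stX - loss i))).
    by apply: ler_sum.
  have n0 : (0 < n)%N := leq_ltn_trans (leq0n c) (ltn_ord c).
  rewrite sumrB sumr_const cardC1 card_ord -subn1 mulrnBr // mulrBl mul1r mulr_natl.
  rewrite lerD2l lerN2 [leRHS](bigID (mem C)) /=.
  rewrite (eq_bigl (fun w => (w != c) && (w \in C))); last by move=> w; rewrite andbC.
  by rewrite lerDl; apply: sumr_ge0 => w _; apply: mass_ge0.
(* The losses in [cle] and [rest] cancel, and so do the two masses of [k < num_x]. *)
have := mass_outcome_le pi g; rewrite (bigD1 c) //=; lra.
Qed.

End Masses.

(** * Domination-free networks *)

Definition domination_free n (g : network n) : Prop :=
  forall i j : 'I_n, i != j -> ~~ (neighborhood g j \subset neighborhood g i).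

Lemma empty_network_domination_free n : domination_free (empty_network n).
Proof.
move=> i j ij; apply/negP => /subsetP/(_ j).
by rewrite !inE eqxx orbT eq_sym (negbTE ij) => /(_ isT).
Qed.

(** * Experiments on finitely many encoded signals *)

Section FiniteExperiment.

Variables (R : realType) (n : nat) (Msg : countType) (S : finType).
Variables (enc : S -> signal n Msg) (dec : signal n Msg -> S) (p : state -> S -> R).
Hypotheses (encK : cancel enc dec) (p_ge0 : forall w s, 0 <= p w s).
Hypothesis p_sum1 : forall w, \sum_s p w s = 1.

Let supp : {fset signal n Msg} := [fset enc s | s in S]%fset.

Let prob_fun (w : state) : {fsfun signal n Msg -> R with 0} :=
  [fsfun t in supp => p w (dec t)].

Let prob_funE w s : prob_fun w (enc s) = p w s.
Proof. by rewrite fsfunE encK ifT //; apply/imfsetP; exists s. Qed.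

Let sum_prob_fun w (P : pred (signal n Msg)) :
  \sum_(t <- finsupp (prob_fun w) | P t) prob_fun w t = \sum_(s | P (enc s)) p w s.
Proof.
rewrite big_mkcond (big_fset_incl _ (B := supp)) /=.
- rewrite big_imfset /=; last by move=> s t _ _; apply: (can_inj encK).
  by rewrite big_enum /= [RHS]big_mkcond; apply: eq_bigr => s _; rewrite prob_funE.
- exact: finsupp_sub.
- by move=> t _ /fsfun_dflt ->; rewrite if_same.
Qed.

Let prob_fun_ge0 w t : 0 <= prob_fun w t.
Proof. by rewrite fsfunE; case: ifP. Qed.

Let prob_fun_sum1 w : \sum_(t <- finsupp (prob_fun w)) prob_fun w t = 1.
Proof. by rewrite sum_prob_fun p_sum1. Qed.

Definition finite_experiment : experiment R n Msg := Experiment prob_fun_ge0 prob_fun_sum1.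

Lemma finite_experimentE w s : finite_experiment w (enc s) = p w s.
Proof. exact: prob_funE. Qed.

Lemma mass_finite_experiment (lam0 : state -> R) w (P : pred (signal n Msg)) :
  mass lam0 finite_experiment w P = lam0 w * \sum_(s | P (enc s)) p w s.
Proof. by rewrite massE sum_prob_fun. Qed.

End FiniteExperiment.

(** An injection of the natural numbers into [T] is applied to a numbering of [F]; [v0] is the value
    of [decode] off the range of [code]. *)
Lemma infinite_code (T : choiceType) (F : finType) (v0 : F) :
    infinite_set [set: T]%classic ->
  exists (code : F -> T) (decode : T -> F), cancel code decode.
Proof.
move=> /infiniteP/card_leP[f].
pose code (v : F) : T := val (f (to_setT (enum_rank v : nat))).
exists code, (fun t => odflt v0 [pick v | code v == t]) => v.
case: pickP => [u /eqP/val_inj/inj|/(_ v)]; last by rewrite eqxx.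
move=> /(_ (mem_set I) (mem_set I)) E.
by move: (congr1 (fun a => val a) E) => /= /val_inj/enum_rank_inj ->.
Qed.

(** * Secret sharing on a network *)

Section SecretSharing.

Variables (n : nat) (g : network n).

(** [s i j] is the share of the secret of [j] that is carried by the message of [i]. *)
Definition shares : finType := {ffun 'I_n -> {ffun 'I_n -> bool}}.
Implicit Types (s t : shares) (K : {set 'I_n}) (m : 'I_n -> 'I_n).

Definition parity s (j : 'I_n) : bool := \big[addb/false]_(i in neighborhood g j) s i j.

Definition fooled s : {set 'I_n} := [set j | ~~ parity s j].

(** [m j] selects the share of [j] to toggle; if it lies in the neighborhood of [j], her parity is
    reversed. *)
Definition flip K m s : shares :=
  [ffun i => [ffun j => s i j (+) ((j \notin K) && (i == m j))]].

Lemma flipK K m : involutive (flip K m).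
Proof.
by move=> s; apply/ffunP=> i; apply/ffunP=> j; rewrite !ffunE -addbA addbb addbF.
Qed.

Lemma parity_flip K m s j : (j \notin K -> m j \in neighborhood g j) ->
  parity (flip K m s) j = parity s j (+) (j \notin K).
Proof.
move=> mj; rewrite /parity; under eq_bigr do rewrite !ffunE.
case: (boolP (j \in K)) mj => /= _ mj.
  by rewrite addbF; apply: eq_bigr => i _; rewrite addbF.
rewrite big_split /=; congr (_ (+) _).
by rewrite (bigD1 (m j)) ?mj //= eqxx big1 // => i /andP[_ /negbTE ->].
Qed.

Lemma fooled_flip K m s : (forall j, j \notin K -> m j \in neighborhood g j) ->
  (fooled (flip K m s) == K) = (fooled s == setT).
Proof.
move=> mN; have E j : (j \in fooled (flip K m s)) = (j \in K) (+) (j \notin fooled s).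
  rewrite !inE parity_flip; last exact: mN.
  by case: (_ \in K); case: parity.
apply/eqP/eqP => [/setP FK|/setP FT]; apply/setP => j.
  by move: (FK j); rewrite E in_setT; case: (_ \in K); case: (_ \in fooled s).
by rewrite E FT in_setT addbF.
Qed.

(** The involution [flip K m] preserves [P] and exchanges the vectors that fool everyone with those
    that fool exactly [K]. *)
Lemma card_fooled K m (P : pred shares) :
    (forall j, j \notin K -> m j \in neighborhood g j) ->
    (forall s, P (flip K m s) = P s) ->
  #|[set s | (fooled s == K) && P s]| = #|[set s | (fooled s == setT) && P s]|.
Proof.
move=> mN PK; rewrite -!sum1_card (reindex_inj (inv_inj (flipK K m))) /=.
by apply: eq_bigl => s; rewrite !inE fooled_flip // PK.
Qed.

Variables (R : realType) (Msg : countType) (x y : Msg) (lam0 : state -> R) (k : nat).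
Hypotheses (xy : x != y) (lam0_gt0 : forall w, 0 < lam0 w).
Hypothesis g_free : domination_free g.
Variables (code : {ffun 'I_n -> bool} -> Msg) (decode : Msg -> {ffun 'I_n -> bool}).
Hypothesis codeK : cancel code decode.
(* [rho w K] is the probability that K is the set of fooled receivers in state w. *)
Variable rho : state -> {set 'I_n} -> R.
Hypotheses (rho_ge0 : forall w K, 0 <= rho w K) (rho_sum1 : forall w, \sum_K rho w K = 1).
Hypothesis rho_X : forall K, K != setT -> rho stX K = 0.
(** In state X everyone is fooled, so this makes a fooled receiver indifferent between the states,
    which is just enough for her to play x. *)
Hypothesis rho_Y : forall i, lam0 stY * \sum_(K : {set 'I_n} | i \in K) rho stY K = lam0 stX.

Let enc s : signal n Msg := [ffun i => code (s i)].
Let dec (t : signal n Msg) : shares := [ffun i => decode (t i)].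

Let encK : cancel enc dec.
Proof. by move=> s; apply/ffunP => i; rewrite !ffunE codeK. Qed.

Let N : R := #|[set s | fooled s == setT]|%:R.

Let N_gt0 : 0 < N.
Proof.
rewrite ltr0n; apply/card_gt0P; exists [ffun=> [ffun=> false]].
by rewrite !inE; apply/eqP/setP => j; rewrite !inE /parity big1 // => i _; rewrite !ffunE.
Qed.

(** By [card_fooled] each [K] is the fooled set of exactly [N] share vectors, so [p] is uniform
    given the fooled set. *)
Let p w s := rho w (fooled s) / N.

Let p_ge0 w s : 0 <= p w s.
Proof. by rewrite divr_ge0 // ltW. Qed.

Let sum_fooled w (P : pred shares) (Q : pred {set 'I_n}) :
  \sum_(s | P s && Q (fooled s)) p w s =
  \sum_(K | Q K) rho w K / N * #|[set s | (fooled s == K) && P s]|%:R.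
Proof.
rewrite (partition_big fooled Q) => [|s /andP[]] //=.
apply: eq_bigr => K QK; rewrite mulr_natr -sumr_const.
apply: eq_big => s; first by rewrite inE; case: eqP => [->|]; rewrite ?andbF ?QK ?andbT.
by case/andP => _ /eqP E; rewrite /p E.
Qed.

Let sum_all_fooled w (Q : pred {set 'I_n}) :
  \sum_(s | Q (fooled s)) p w s = \sum_(K | Q K) rho w K.
Proof.
rewrite (sum_fooled w predT Q); apply: eq_bigr => K _.
rewrite (@card_fooled K id predT) // => [|j _]; last by rewrite !inE eqxx orbT.
have -> : [set s | (fooled s == setT) && predT s] = [set s | fooled s == setT].
  by apply/setP => s; rewrite !inE andbT.
by rewrite -/N divfK // gt_eqF.
Qed.

Let p_sum1 w : \sum_s p w s = 1.
Proof. by rewrite (sum_all_fooled w predT). Qed.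

Definition sharing_experiment := finite_experiment encK p_ge0 p_sum1.
Local Notation pi := sharing_experiment.

Let agree_fooled i s t : agree g i (enc s) (enc t) -> (i \in fooled s) = (i \in fooled t).
Proof.
move=> /forall_inP st; rewrite !inE /parity; congr (~~ _); apply: eq_bigr => j jN.
by have := st _ jN; rewrite !ffunE => /eqP/(can_inj codeK) ->.
Qed.

(* Every j other than i has a share that i does not see, so that changing the
   parity of the shares of j is invisible to i. *)
Let card_agree i s (K : {set 'I_n}) : i \in K ->
  #|[set t | (fooled t == K) && agree g i (enc s) (enc t)]| =
  #|[set t | (fooled t == setT) && agree g i (enc s) (enc t)]|.
Proof.
move=> iK; have hidden j : exists a, j \notin K ->
    (a \in neighborhood g j) && (a \notin neighborhood g i).
  have [ij|ij] := eqVneq i j; first by exists j; rewrite -ij iK.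
  by have /subsetPn[a aj ai] := g_free ij; exists a; rewrite aj.
have [m mP] := choice hidden.
rewrite (card_fooled (m := m)) // => [j /mP/andP[]//|t].
apply: eq_forallb_in => a ai; congr (_ == _); rewrite !ffunE; congr (code _).
apply/ffunP => j; rewrite !ffunE; case: (boolP (j \in K)) => [|/mP/andP[_ mi]].
  by rewrite addbF.
by case: eqP => [E|_]; [rewrite -E ai in mi|rewrite addbF].
Qed.

(** By [card_agree] the share vectors compatible with what [i] sees are equally many for every
    fooled set containing [i]. The state thus enters only through its prior and the probability that
    [i] is fooled. *)
Let mass_agree i s w : i \in fooled s ->
  mass lam0 pi w (agree g i (enc s)) =
  lam0 w * (\sum_(K : {set 'I_n} | i \in K) rho w K) *
    (#|[set t | (fooled t == setT) && agree g i (enc s) (enc t)]|%:R / N).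
Proof.
move=> is_; rewrite mass_finite_experiment -mulrA; congr (_ * _).
rewrite (eq_bigl (fun t => agree g i (enc s) (enc t) && (i \in fooled t))); last first.
  by move=> t; case: (boolP (agree _ _ _ _)) => //= /agree_fooled <-.
rewrite (sum_fooled w (fun t => agree g i (enc s) (enc t)) (fun K => i \in K)) mulr_suml.
by apply: eq_bigr => K iK; rewrite card_agree // mulrAC -mulrA.
Qed.

Let sum_rho_X (Q : pred {set 'I_n}) : Q setT -> \sum_(K | Q K) rho stX K = 1.
Proof.
move=> QT; rewrite -(rho_sum1 stX) [RHS](bigID Q) /= [X in _ + X]big1 ?addr0 // => K QK.
by apply: rho_X; apply: contraNneq QK => ->.
Qed.

(** For a fooled receiver the masses tie by [rho_Y], and ties go to x. For any other, state X is
    excluded, because everyone is fooled there. *)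
Let sharing_acts_x i s : enc s \in signals_of pi ->
  acts_x x y lam0 pi g i (enc s) = (i \in fooled s).
Proof.
move=> sS; rewrite acts_xE //; case: (boolP (i \in fooled s)) => is_.
  by rewrite !mass_agree // rho_Y (@sum_rho_X (fun K => i \in K)) ?inE // mulr1 lexx.
have X0 : mass lam0 pi stX (agree g i (enc s)) = 0.
  rewrite mass_finite_experiment big1 ?mulr0 // => t /agree_fooled E.
  by rewrite /p rho_X ?mul0r //; apply: contraNneq is_ => T; rewrite E T inE.
have := mass_gt0 lam0_gt0 sS (agreexx g i (enc s)).
by rewrite X0 add0r leNgt => ->.
Qed.

Lemma sharing_exp_value : (k <= n)%N ->
  exp_value x y lam0 k pi g =
  lam0 stX + lam0 stY * \sum_(K : {set 'I_n} | (k <= #|K|)%N) rho stY K.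
Proof.
move=> kn.
have E w : mass lam0 pi w (fun u => (k <= num_x x y lam0 pi g u)%N) =
    lam0 w * \sum_(K : {set 'I_n} | (k <= #|K|)%N) rho w K.
  rewrite mass_finite_experiment -(sum_all_fooled w (fun K => (k <= #|K|)%N)).
  congr (_ * _); rewrite big_mkcond [RHS]big_mkcond; apply: eq_bigr => s _.
  (* Actions are known only at signals sent with positive probability; the others contribute 0. *)
  have [->|ps] := eqVneq (p w s) 0; first by rewrite !if_same.
  suff -> : num_x x y lam0 pi g (enc s) = #|fooled s| by [].
  apply: eq_card => i; rewrite inE sharing_acts_x //.
  by apply: (fsubsetP (finsupp_signals pi w)); rewrite mem_finsupp finite_experimentE.
rewrite exp_valueE // !E; congr (_ + _).
by rewrite sum_rho_X ?mulr1 // cardsT card_ord.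
Qed.

End SecretSharing.

(** * The value of a network *)

Section OptimalValue.

Variables (R : realType) (n : nat) (Msg : countType) (x y : Msg) (lam0 : state -> R) (k : nat).
Hypotheses (Msg_infinite : infinite_set [set: Msg]%classic) (xy : x != y).
Hypotheses (lam0X : 0 < lam0 stX) (lam0Y : 0 < lam0 stY).
Hypothesis lam0_sum1 : \sum_(w : state) lam0 w = 1.
Hypotheses (k_gt0 : (0 < k)%N) (k_le : (k <= n)%N).
Hypothesis lam0_small : lam0 stX < k%:R / (n + k)%:R.
Implicit Types g : network n.

Let lam0_gt0 w : 0 < lam0 w.
Proof. by case: w. Qed.

Let kR_gt0 : 0 < k%:R :> R.
Proof. by rewrite ltr0n. Qed.

Let nR_gt0 : 0 < n%:R :> R.
Proof. by rewrite ltr0n (leq_trans k_gt0). Qed.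

Let lam0YE : lam0 stY = 1 - lam0 stX.
Proof. by have : lam0 stX + lam0 stY = 1; [rewrite -lam0_sum1 big_bool|lra]. Qed.

Lemma exp_value_le (pi : experiment R n Msg) g (r : R) :
    k%:R * mass lam0 pi stY (fun s => (k <= num_x x y lam0 pi g s)%N) <= r * lam0 stX ->
  exp_value x y lam0 k pi g <= lam0 stX * (1 + r / k%:R).
Proof.
move=> le_r; rewrite exp_valueE // mulrDr mulr1 lerD //.
  by rewrite -[leRHS](mass_predT lam0 pi); apply: mass_le.
by rewrite mulrA ler_pdivlMr // mulrC [leRHS]mulrC.
Qed.

Lemma optimal_experiment_exists g : domination_free g ->
  exists pi : experiment R n Msg, exp_value x y lam0 k pi g = lam0 stX * (1 + n%:R / k%:R).
Proof.
move=> g_free.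
have [code [decode codeK]] := infinite_code ([ffun=> false] : {ffun 'I_n -> bool}) Msg_infinite.
(* In state Y, [b] is the probability of fooling some set of size [k]. A receiver lies in a fraction
   k/n of these sets, so [rho_Y] requires lam0 stY * b * k / n = lam0 stX. *)
pose b : R := n%:R * lam0 stX / (k%:R * lam0 stY).
have b_ge0 : 0 <= b by rewrite divr_ge0 // ?mulr_ge0 // ltW.
(* The bound on the prior enters here: [b <= 1] amounts to lam0 stX <= k / (n + k). *)
have b_le1 : b <= 1.
  rewrite ler_pdivrMr ?mulr_gt0 // mul1r lam0YE.
  move: lam0_small; rewrite ltr_pdivlMr ?ltr0n ?addn_gt0 ?k_gt0 ?orbT // natrD; lra.
pose c : R := b / 'C(n, k)%:R.
have C_gt0 : 0 < 'C(n, k)%:R :> R by rewrite ltr0n bin_gt0.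
pose rho (w : state) (K : {set 'I_n}) : R :=
  if w then (K == setT)%:R else (#|K| == k)%:R * c + (K == set0)%:R * (1 - b).
have sumY (Q : pred {set 'I_n}) : \sum_(K | Q K) rho stY K =
    #|[set K : {set 'I_n} | Q K & #|K| == k]|%:R * c + (Q set0)%:R * (1 - b).
  rewrite /= big_split /= -!mulr_suml; congr (_ * _ + _ * _).
    rewrite -natr_sum; congr _%:R; rewrite -sum1_card [RHS]big_mkcond [LHS]big_mkcond /=.
    by apply: eq_bigr => K _; rewrite inE; case: (Q K); case: (_ == _).
  rewrite -natr_sum big_mkcond (bigD1 set0) //= eqxx big1 ?addn0; first by case: (Q _).
  by move=> K /negbTE ->; rewrite if_same.
have cardk : #|[set K : {set 'I_n} | #|K| == k]| = 'C(n, k).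
  by rewrite card_draws card_ord.
have rho_ge0 w K : 0 <= rho w K.
  by case: w => /=; rewrite ?ler0n // addr_ge0 // mulr_ge0 ?ler0n ?subr_ge0 // divr_ge0 // ltW.
have rho_sum1 w : \sum_K rho w K = 1.
  case: w => /=.
    by rewrite (bigD1 setT) //= eqxx big1 ?addr0 // => K /negbTE ->.
  rewrite (sumY predT) /= cardk /c mul1r mulrCA divff ?gt_eqF // mulr1; lra.
have rho_X K : K != setT -> rho stX K = 0 by move=> /negbTE /= ->.
have rho_Y i : lam0 stY * \sum_(K : {set 'I_n} | i \in K) rho stY K = lam0 stX.
  rewrite sumY inE mul0r addr0.
  (* The sets of size [k] containing [i] are counted through those avoiding [i] and Pascal's
     rule. *)
  have bin : (n * #|[set K : {set 'I_n} | i \in K & #|K| == k]| = k * 'C(n, k))%N.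
    have := cardsID [set K : {set 'I_n} | i \in K] [set K : {set 'I_n} | #|K| == k].
    rewrite cardk.
    have -> : [set K : {set 'I_n} | #|K| == k] :&: [set K : {set 'I_n} | i \in K] =
      [set K : {set 'I_n} | i \in K & #|K| == k] by apply/setP => K; rewrite !inE andbC.
    have -> : [set K : {set 'I_n} | #|K| == k] :\: [set K : {set 'I_n} | i \in K] =
      [set K : {set 'I_n} | K \subset [set~ i] & #|K| == k].
      by apply/setP => K; rewrite !inE subsetC sub1set inE.
    rewrite cards_draws cardsC1 card_ord.
    case: k k_gt0 => // k' _ E; have := mul_bin_diag n k'; move: E.
    case: n i => [[]//|n' i]; rewrite binS /=; nia.
  move/(congr1 (fun m => m%:R : R)): bin; rewrite !natrM /c /b.
  set a := #|_|%:R; set C := 'C(n, k)%:R => /(canRL (mulKf (lt0r_neq0 nR_gt0))) ->.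
  by field; rewrite !gt_eqF.
exists (sharing_experiment g codeK rho_ge0 rho_sum1).
rewrite (sharing_exp_value xy lam0_gt0 g_free codeK rho_ge0 rho_sum1 rho_X rho_Y k_le).
rewrite sumY cards0 leqNgt k_gt0 mul0r addr0.
have -> : [set K : {set 'I_n} | (k <= #|K|)%N & #|K| == k] = [set K : {set 'I_n} | #|K| == k].
  by apply/setP => K; rewrite !inE; case: eqP => [->|]; rewrite ?leqnn ?andbF.
by rewrite cardk /c /b; field; rewrite !gt_eqF.
Qed.

Lemma net_value_le g (r : R) :
    (forall pi : experiment R n Msg, exp_value x y lam0 k pi g <= r) ->
  net_value x y lam0 k g <= r.
Proof.
(* Bounding a supremum needs a nonempty set; the empty network supplies an experiment. *)
move=> le_r; have [pi _] := optimal_experiment_exists (@empty_network_domination_free n).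
by apply: ge_sup; [exists (exp_value x y lam0 k pi g), pi|move=> _ [pi' _ <-]].
Qed.

Lemma net_value_domination_free g : domination_free g ->
  net_value x y lam0 k g = lam0 stX * (1 + n%:R / k%:R).
Proof.
move=> g_free.
have ub (pi : experiment R n Msg) : exp_value x y lam0 k pi g <= lam0 stX * (1 + n%:R / k%:R).
  by apply: exp_value_le; apply: mass_outcome_upper.
apply/le_anti/andP; split; first exact: net_value_le.
have [pi <-] := optimal_experiment_exists g_free.
apply: ub_le_sup; last by exists pi.
by exists (lam0 stX * (1 + n%:R / k%:R)) => _ [pi' _ <-].
Qed.

(** The gap lam0 stX / k is the same for all experiments, so the inequality stays strict for the
    supremum. *)
Lemma net_value_center_lt g (C : {set 'I_n}) (c : 'I_n) :
    (k < #|C|)%N ->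
    (forall w, w \in C -> neighborhood g w \subset neighborhood g c) ->
  net_value x y lam0 k g < lam0 stX * (1 + n%:R / k%:R).
Proof.
move=> Ck Cc; apply: (@le_lt_trans _ _ (lam0 stX * (1 + (n%:R - 1) / k%:R))).
  by apply: net_value_le => pi; apply: exp_value_le; apply: mass_outcome_center Cc.
by rewrite ltr_pM2l // ltrD2l ltr_pM2r ?invr_gt0 // gtrBl.
Qed.

End OptimalValue.

(** * Coloring constellations *)

Local Open Scope nat_scope.

(** All [q] colors must occur, because colors will stand for receivers outside [C], who are told
    apart by their links into [C]. *)
Definition coloring (T : finType) (e : rel T) (D : {set T}) (q : nat) (f : T -> nat) : Prop :=
  [/\ {in D, forall u, f u < q},
      forall c, c < q -> exists2 u, u \in D & f u = c
    & {in D &, forall u v, e u v -> f u != f v}].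

(* Each node is colored by the height of its subtree. *)
Lemma stellar_coloring (T : finType) (e : rel T) (D : {set T}) (r : T) (A : {set T * T}) :
    symmetric e -> irreflexive e -> stellar e D r A ->
  exists (f : T -> nat) (p : seq T),
    [/\ path (fun a b => (a, b) \in A) r p, size p < #|D|,
        {in D, forall u, f u <= size p}
      & {in D &, forall u v, e u v -> f u != f v}].
Proof.
move=> e_sym e_irr; elim=> {D r A} [r|D r P rt A rD er Ppart P2 _ IH Pe].
  exists (fun=> 0), [::]; split=> //; first by rewrite cards1.
  by move=> u v /set1P -> /set1P ->; rewrite e_irr.
have IH' B : exists fB : (T -> nat) * seq T, B \in P ->
    [/\ path (fun a b => (a, b) \in A B) (rt B) fB.2, size fB.2 < #|B|,
        {in B, forall u, fB.1 u <= size fB.2}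
      & {in B &, forall u v, e u v -> fB.1 u != fB.1 v}].
  case: (boolP (B \in P)) => [/IH[f [p H]]|_]; first by exists (f, p).
  by exists (fun=> 0, [::]).
have [fp fpP] := choice IH'.
have [B0 B0P] : exists B0, B0 \in P by apply/card_gt0P; apply: leq_trans P2.
pose B := [arg max_(B > B0 in P) size (fp B).2].
have [BP Bmax] : B \in P /\ forall B', B' \in P -> size (fp B').2 <= size (fp B).2.
  by rewrite /B; case: arg_maxnP => // B' B'P H; split.
have [Bpath Bsize _ _] := fpP _ BP.
have cov v : v \in D -> v != r -> exists2 B', B' \in P & v \in B'.
  move=> vD vr; have : v \in D :\ r by rewrite !inE vr.
  by rewrite -(cover_partition Ppart) => /bigcupP.
have BD B' : B' \in P -> B' \subset D :\ r.
  by move=> B'P; rewrite -(cover_partition Ppart) bigcup_sup.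
have trivP : trivIset P by case/and3P: Ppart.
have blk B' v : B' \in P -> v \in B' -> pblock P v = B' by move=> *; apply: def_pblock.
have rB B' v : B' \in P -> v \in B' -> (v == r) = false.
  by move=> /BD/subsetP H /H; rewrite !inE => /andP[/negbTE].
(* The root gets a color above those of all blocks; blocks may share colors, since no edge joins two
   of them. *)
exists (fun v => if v == r then (size (fp B).2).+1 else (fp (pblock P v)).1 v), (rt B :: (fp B).2).
split=> /=.
- rewrite inE; apply/andP; split.
    by apply/orP; left; apply/imsetP; exists B.
  apply: sub_path Bpath => a b ab; rewrite inE; apply/orP; right.
  by apply/bigcupP; exists B.
- rewrite (cardsD1 r) rD add1n ltnS; apply: leq_trans Bsize _.
  exact/subset_leq_card/BD.
- move=> v vD; case: eqVneq => [//|vr]; have [B' B'P vB'] := cov v vD vr.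
  have [_ _ /(_ v vB') H _] := fpP _ B'P.
  by rewrite (blk B') // (leq_trans H) // (leq_trans (Bmax _ B'P)).
- have root v : v \in D -> v != r -> (fp (pblock P v)).1 v < (size (fp B).2).+1.
    move=> vD vr; have [B' B'P vB'] := cov v vD vr.
    have [_ _ /(_ v vB') H _] := fpP _ B'P.
    by rewrite (blk B') // ltnS (leq_trans H) // Bmax.
  move=> u v uD vD; case: (eqVneq u r) => [->|ur]; case: (eqVneq v r) => [->|vr].
  + by rewrite e_irr.
  + by move=> _; rewrite gtn_eqF // root.
  + by move=> _; rewrite ltn_eqF // root.
  have [B1 B1P uB1] := cov u uD ur; have [B2 B2P vB2] := cov v vD vr.
  rewrite (blk B1) // (blk B2) //; have [B12|B12] := eqVneq B1 B2.
    by rewrite -B12 in vB2 *; have [_ _ _] := fpP _ B1P; apply.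
  by rewrite (negbTE (Pe _ _ B1P B2P B12 _ _ uB1 vB2)).
Qed.

Lemma leq_longest_path (T : finType) (A : {set T * T}) (r : T) (p : seq T) :
  path (fun a b => (a, b) \in A) r p -> size p < #|T| -> size p <= longest_path A.
Proof.
move=> rp pT; apply: (leq_bigmax_cond (Ordinal pT)) => /=.
apply/existsP; exists r; apply/existsP.
by exists (in_tuple p).
Qed.

Section Constellation.

Variables (T : finType) (e : rel T) (D M : {set T}).
Hypotheses (e_sym : symmetric e) (e_irr : irreflexive e) (DM : is_constellation e D M).
Local Notation U := (D :\: M).

Let link_center i u : i \in M -> u \in U -> e i u.
Proof.
case: DM => _ _ H _ iM; rewrite inE => /andP[uM uD]; apply: H => //.
by apply: contraNneq uM => ->.
Qed.

(** A center [i] must be the root of the stellar network on [U] and [i], as any other node lacks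
    links to the other blocks. Then [u] lies in a block, and any node of another block serves as
    [v]. *)
Lemma constellation_nonadjacent u : u \in U -> exists v, [/\ v \in U, v != u & ~~ e u v].
Proof.
case: DM => /set0Pn[i iM] _ _ /(_ i iM) [r0 [A0 st]] uU.
have iU : i \notin U by rewrite inE iM.
have iUi : i \in U :|: [set i] by rewrite !inE eqxx orbT.
have uUi : u \in U :|: [set i] by rewrite inE uU.
have ui : u != i by apply: contraNneq iU => <-.
move: {-1}(U :|: [set i]) (erefl (U :|: [set i])) st => D0 ED' st.
case: st ED' => [r1 E|D' r P rt A rD er Ppart P2 _ Pe ED'].
  by move: iUi uUi; rewrite E !inE => /eqP ir /eqP ur; rewrite ir ur eqxx in ui.
have cov v : v \in D' -> v != r -> exists2 B, B \in P & v \in B.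
  move=> vD vr; have : v \in D' :\ r by rewrite !inE vr.
  by rewrite -(cover_partition Ppart) => /bigcupP.
have other B : B \in P -> exists B' v, [/\ B' \in P, B != B', v \in B', v \in D' & v != r].
  move=> BP; have : 0 < #|P :\ B| by move: P2; rewrite (cardsD1 B) BP.
  case/card_gt0P => B'; rewrite !inE => /andP[B'B B'P].
  have /set0Pn[v vB'] : B' != set0.
    by apply: contraTneq B'P => ->; case/and3P: Ppart.
  have : v \in D' :\ r by rewrite -(cover_partition Ppart); apply/bigcupP; exists B'.
  by rewrite !inE => /andP[vr vD]; exists B', v; rewrite eq_sym.
have ri : i = r.
  apply/eqP/negPn/negP => ir; have [B BP iB] := cov i (ltac:(by rewrite -ED')) ir.
  have [B' [v [B'P BB' vB' vD _]]] := other B BP.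
  have /negP[] := Pe _ _ BP B'P BB' _ _ iB vB'.
  apply: link_center => //; move: vD; rewrite -ED' inE => /orP[//|/set1P vi].
  case/negP: BB'; case/and3P: Ppart => _ trivP _.
  by rewrite -(def_pblock trivP BP iB) -(def_pblock trivP B'P vB') vi.
have [B BP uB] : exists2 B, B \in P & u \in B by apply: cov; rewrite -?ED' // -ri.
have [B' [v [B'P BB' vB' vD vr]]] := other B BP.
exists v; split.
- by move: vD; rewrite -ED' inE => /orP[//|/set1P E]; rewrite E ri eqxx in vr.
- apply: contraNneq BB' => vu; case/and3P: Ppart => _ trivP _.
  by rewrite -(def_pblock trivP BP uB) -(def_pblock trivP B'P vB') vu.
- exact: Pe BB' _ _ uB vB'.
Qed.

(** The height coloring of [U] with a center [i] uses at most one color more than the depth. As [i]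
    is linked to all of [U], its color is free there; the remaining colors are renumbered by their
    index in [S]. *)
Lemma constellation_coloring l : constellation_depth e D M l ->
  exists q f, q <= l /\ coloring e U q f.
Proof.
case=> d [dM ->]; case: (DM) => /set0Pn[i iM] _ _ _.
have [r [A [st dA]]] := dM i iM.
have [f [p [rp pU fp fe]]] := stellar_coloring e_sym e_irr st.
have pd : size p <= d i by rewrite -dA (leq_longest_path rp) // (leq_trans pU) // max_card.
pose S := undup [seq f u | u <- enum U].
have SP c : (c \in S) = [exists u in U, f u == c].
  rewrite mem_undup; apply/mapP/exists_inP => [[u]|[u uU /eqP <-]].
    by rewrite mem_enum => uU ->; exists u.
  by exists u; rewrite ?mem_enum.
have fS u : u \in U -> f u \in S by move=> uU; rewrite SP; apply/exists_inP; exists u.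
have Ui u : u \in U -> u \in U :|: [set i] by move=> uU; rewrite inE uU.
have iUi : i \in U :|: [set i] by rewrite !inE eqxx orbT.
exists (size S), (fun u => index (f u) S); split.
  have dl : d i <= \max_(j in M) d j by apply: leq_bigmax_cond.
  apply: leq_trans (leq_trans pd dl).
  have /uniq_leq_size : {subset S <= rem (f i) (iota 0 (size p).+1)}.
    move=> c; rewrite SP => /exists_inP[u uU /eqP <-].
    rewrite mem_rem_uniq ?iota_uniq // inE mem_iota /= add0n ltnS fp ?Ui // andbT eq_sym.
    by apply: fe; [exact: iUi|exact: Ui|exact: link_center].
  rewrite undup_uniq size_rem ?size_iota => [/(_ isT)//|].
  by rewrite mem_iota /= add0n ltnS fp.
split=> [u uU|c cS|u v uU vU euv]; first by rewrite index_mem fS.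
  have := mem_nth 0 cS; rewrite SP => /exists_inP[u uU /eqP fu].
  by exists u; rewrite // fu index_uniq ?undup_uniq.
apply/negP => /eqP fuv; have /negP[] := fe u v (Ui _ uU) (Ui _ vU) euv; apply/eqP.
by rewrite -(nth_index 0 (fS u uU)) fuv nth_index ?fS.
Qed.

End Constellation.

(** With fewer colors than nodes, two nodes share a color, and one of them can be given a new
    color. *)
Lemma refine_coloring (T : finType) (e : rel T) (D : {set T}) (q : nat) (f : T -> nat) (q' : nat) :
    coloring e D q f -> q <= q' <= #|D| -> exists f', coloring e D q' f'.
Proof.
move=> fP /andP[]; elim: q' => [|q' IH] qq' q'D.
  by move: qq' fP; rewrite leqn0 => /eqP ->; exists f.
move: qq'; rewrite leq_eqVlt => /orP[/eqP <-|]; first by exists f.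
rewrite ltnS => /IH /(_ (ltnW q'D)) [h [hq hsurj he]].
have [u uD [v vD [uv huv]]] : exists2 u, u \in D & exists2 v, v \in D & u != v /\ h u = h v.
  apply: contrapT => ninj.
  have h_inj : {in D &, injective h}.
    move=> u v uD vD huv; apply/eqP/negPn/negP => uv.
    by apply: ninj; exists u => //; exists v.
  have : {subset [seq h u | u <- enum D] <= iota 0 q'}.
    by move=> _ /mapP[u + ->]; rewrite mem_enum mem_iota => /hq.
  move/uniq_leq_size; rewrite map_inj_in_uniq ?enum_uniq => [/(_ isT)|x y]; last first.
    by rewrite !mem_enum; apply: h_inj.
  by rewrite size_map -cardE size_iota leqNgt q'D.
exists (fun w => if w == u then q' else h w); split.
- by move=> w wD; case: eqP => // _; rewrite ltnS ltnW ?hq.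
- move=> c; rewrite ltnS leq_eqVlt => /orP[/eqP ->|/hsurj[w wD hw]].
    by exists u; rewrite ?eqxx.
  have [wu|wu] := eqVneq w u; last by exists w; rewrite // (negbTE wu).
  by exists v; rewrite // eq_sym (negbTE uv) -huv -wu.
- move=> w w' wD w'D ew; have := he _ _ wD w'D ew.
  case: (eqVneq w u) => [wu|wu]; case: (eqVneq w' u) => [w'u|w'u] //.
  + by rewrite wu w'u eqxx.
  + by move=> _; rewrite gtn_eqF ?hq.
  + by move=> _; rewrite ltn_eqF ?hq.
Qed.

(** * Domination-free extensions *)

Section Extension.

Variables (n : nat) (g : network n) (C : {set 'I_n}).
Hypothesis C_component : is_component g C.
(* The receivers outside C are numbered by 0, ..., #|~: C| - 1; [c u m] says
   that u in C is to be linked with the receiver number m. *)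
Variable c : 'I_n -> nat -> bool.

Let rank (o : 'I_n) : nat := index o (enum (~: C)).

Definition extension_link (i j : 'I_n) : bool :=
  g i j || (i != j) &&
  [|| (i \notin C) && (j \notin C), [&& i \in C, j \notin C & c i (rank j)]
    | [&& j \in C, i \notin C & c j (rank i)]].

Lemma extension_link_sym : symmetric extension_link.
Proof.
move=> i j; rewrite /extension_link (link_sym g) eq_sym; congr (_ || _ && _).
by case: (i \in C); case: (j \in C); rewrite /= ?orbF.
Qed.

Lemma extension_link_irr : irreflexive extension_link.
Proof. by move=> i; rewrite /extension_link (link_irr g) eqxx. Qed.

Definition extension : network n := Network extension_link_sym extension_link_irr.

Lemma component_link i j : i \in C -> g i j -> j \in C.
Proof.
case: C_component => r ->; rewrite !inE => ri ij.
exact: connect_trans ri (connect1 ij).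
Qed.

Let link_in i j : i \in C -> j \in C -> extension i j = g i j.
Proof. by move=> iC jC; rewrite /= /extension_link iC jC /= andbF orbF. Qed.

Let link_cross i o : i \in C -> o \notin C -> extension i o = c i (rank o).
Proof.
move=> iC oC; rewrite /= /extension_link iC oC (negbTE oC) /= orbF.
case: (boolP (g i o)) => [/(component_link iC)|_ /=]; first by rewrite (negbTE oC).
by case: eqVneq => // io; rewrite -io iC in oC.
Qed.

Let link_out o o' : o \notin C -> o' \notin C -> o != o' -> extension o o'.
Proof. by move=> oC oC' oo'; rewrite /= /extension_link oo' oC oC' orbT. Qed.

Let mem_nbhd i j : (j \in neighborhood extension i) = extension i j || (j == i).
Proof. by rewrite !inE. Qed.

Let rank_lt o : o \notin C -> rank o < #|~: C|.
Proof. by move=> oC; rewrite cardE index_mem mem_enum inE. Qed.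

Let rank_inj o o' : o \notin C -> o' \notin C -> rank o = rank o' -> o = o'.
Proof.
move=> oC oC' E; rewrite -[o](nth_index o (s := enum (~: C))) ?mem_enum ?inE //.
by rewrite -/(rank o) E nth_index // mem_enum inE.
Qed.

Let rank_surj m : m < #|~: C| -> exists2 o, o \notin C & rank o = m.
Proof.
move=> mO; have /card_gt0P[o0 _] : 0 < #|~: C| by apply: leq_trans mO.
have mE : m < size (enum (~: C)) by rewrite -cardE.
exists (nth o0 (enum (~: C)) m); last by rewrite /rank index_uniq ?enum_uniq.
by have := mem_nth o0 mE; rewrite mem_enum inE.
Qed.

Lemma extension_is_extension : 1 < #|~: C| ->
    (forall m m', m < #|~: C| -> m' < #|~: C| -> m != m' ->
       exists u, [/\ u \in C, c u m & ~~ c u m']) ->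
  is_extension g extension.
Proof.
move=> O2 cO; split=> [i j gij|]; first by rewrite /= /extension_link gij.
have [u [uC cu _]] := cO 0 1 (ltnW O2) O2 isT.
have [o oC ro] := rank_surj (ltnW O2).
exists u, o; rewrite link_cross // ro cu /=.
by apply: contra oC; apply: component_link.
Qed.

(** Only linked [i] and [j] matter, as [j] is in her own neighborhood. The hypotheses treat, in
    order: both in [C], both outside, only [i] in [C], only [j] in [C]. *)
Lemma extension_domination_free :
    {in C &, forall u v, g u v ->
      (exists m, [/\ m < #|~: C|, c u m & ~~ c v m]) \/
      (exists w, [/\ w \in C, g u w, ~~ g v w & w != v])} ->
    (forall m m', m < #|~: C| -> m' < #|~: C| -> m != m' ->
       exists u, [/\ u \in C, c u m & ~~ c u m']) ->
    {in C, forall u, exists2 m, m < #|~: C| & ~~ c u m} ->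
    {in C, forall u m, c u m -> exists v, [/\ v \in C, (v == u) || g u v & ~~ c v m]} ->
  domination_free extension.
Proof.
move=> cC cO cCO cOC i j ij; apply/subsetPn.
case: (boolP (extension i j)) => [Eij|nEij]; last first.
  by exists j; rewrite mem_nbhd ?eqxx ?orbT // (negbTE nEij) eq_sym.
case: (boolP (j \in C)) => jC; case: (boolP (i \in C)) => iC.
- have gji : g j i by rewrite (link_sym g) -link_in.
  have [[m [mO cj ci]]|[w [wC gjw giw wi]]] := cC j i jC iC gji.
    have [o oC ro] := rank_surj mO; exists o; rewrite mem_nbhd link_cross // ro ?cj //.
    by rewrite (negbTE ci); apply: contraNneq oC => ->.
  by exists w; rewrite mem_nbhd link_in // ?gjw // (negbTE giw).
- have := Eij; rewrite (link_sym extension) link_cross // => cj.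
  have [v [vC vj cv]] := cOC j jC _ cj.
  exists v; rewrite mem_nbhd; first by rewrite link_in // orbC.
  rewrite (link_sym extension) link_cross // (negbTE cv).
  by apply: contraNneq iC => <-.
- have [m mO cim] := cCO i iC; have [o oC ro] := rank_surj mO.
  exists o; rewrite mem_nbhd.
    by case: (eqVneq o j) => [|oj]; rewrite ?orbT // link_out // eq_sym.
  by rewrite link_cross // ro (negbTE cim); apply: contraNneq oC => ->.
- have rij : rank j != rank i.
    by apply: contraNneq ij => /rank_inj -> //.
  have [u [uC cj ci]] := cO _ _ (rank_lt jC) (rank_lt iC) rij.
  exists u; rewrite mem_nbhd (link_sym extension) link_cross ?cj // (negbTE ci).
  by apply: contraNneq iC => <-.
Qed.

End Extension.

(** Each node of [C] is linked to the receiver of its color. Properness separates linked nodes of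
    [C], surjectivity separates the receivers outside, and a neighbor of [u] in [C] is not linked to
    the receiver of the color of [u]. *)
Lemma coloring_extension (n : nat) (g : network n) (C : {set 'I_n}) (f : 'I_n -> nat) :
    is_component g C -> 1 < #|~: C| -> coloring g C #|~: C| f ->
    {in C, forall u, exists2 v, v \in C & g u v} ->
  exists2 gp : network n, is_extension g gp & domination_free gp.
Proof.
move=> Ccomp O2 [fO fsurj fg] nbr; pose c u m := f u == m.
have cO m m' : m < #|~: C| -> m' < #|~: C| -> m != m' ->
    exists u, [/\ u \in C, c u m & ~~ c u m'].
  by move=> /fsurj[u uC fu] _ mm'; exists u; rewrite /c fu eqxx.
exists (extension g C c); first exact: extension_is_extension.
apply: extension_domination_free => // [u v uC vC uv|u uC|u uC m /eqP <-].
- by left; exists (f u); rewrite /c eqxx fO // eq_sym fg.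
(* Read as a number, this boolean is a color other than [f u]: 1 if [f u] is 0, and 0 otherwise. *)
- by exists (f u == 0); rewrite /c; case: (f u) => [|?] //; apply: ltnW.
- by have [v vC uv] := nbr u uC; exists v; rewrite uv orbT /c eq_sym fg.
Qed.

Lemma domination_free_extension_exists (n : nat) (g : network n) (C M : {set 'I_n}) (l : nat) :
    is_component g C -> is_constellation g C M -> constellation_depth g C M l ->
    maxn l #|M| < #|~: C| -> #|~: C| <= #|C| ->
  exists2 gp : network n, is_extension g gp & domination_free gp.
Proof.
move=> Ccomp CM Cdepth; rewrite gtn_max; set N := #|~: C| => /andP[lN MN] NC.
have [q [f [ql fcol]]] := constellation_coloring (link_sym g) (link_irr g) CM Cdepth.
have [M0 /properP[/subsetP MC [u0 u0C u0M]] gM _] := CM.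
have [i0 i0M] := set0Pn _ M0.
have M_gt0 : 0 < #|M| by rewrite card_gt0.
set U := C :\: M in fcol.
have UE u : (u \in U) = (u \in C) && (u \notin M) by rewrite inE andbC.
have u0U : u0 \in U by rewrite UE u0C.
have gMU i u : i \in M -> u \in U -> g i u.
  by rewrite UE => iM /andP[uC uM]; apply: gM => //; apply: contraNneq uM => ->.
have gUM i u : i \in M -> u \in U -> g u i by move=> *; rewrite (link_sym g) gMU.
(* The centers own the last [#|M|] of the numbers below [N]. *)
pose idx i := N - #|M| + index i (enum M).
have idxN i : i \in M -> idx i < N.
  move=> iM; have : index i (enum M) < #|M| by rewrite cardE index_mem mem_enum.
  rewrite /idx; lia.
have idx_inj i j : i \in M -> idx i = idx j -> i = j.
  move=> iM /addnI E; rewrite -(nth_index i (s := enum M) (x := i)) ?mem_enum // E nth_index //.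
  by rewrite mem_enum -(mem_enum M) -index_mem -E index_mem mem_enum.
have idx_surj m : N - #|M| <= m -> m < N -> exists2 i, i \in M & idx i = m.
  move=> m1 m2; have mM : m - (N - #|M|) < size (enum M) by rewrite -cardE; lia.
  exists (nth i0 (enum M) (m - (N - #|M|))); first by rewrite -mem_enum mem_nth.
  by rewrite /idx index_uniq ?enum_uniq // subnKC.
have [qMN|qMN] := leqP (#|M| + q) N.
(* The other nodes are to use exactly the remaining [N - #|M|] colors; [U] is large enough for that
   because [N <= #|C|]. *)
- have UN : q <= N - #|M| <= #|U|.
    rewrite cardsD (setIidPr _); last exact/subsetP.
    by apply/andP; split; lia.
  have [h [hU hsurj hg]] := refine_coloring fcol UN.
  pose F u := if u \in M then idx u else h u.
  apply: (coloring_extension (f := F) Ccomp); rewrite ?(leq_ltn_trans M_gt0) //.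
    split=> [u uC|m mN|u v uC vC uv]; rewrite /F.
    + by case: ifPn => [/idxN//|uM]; rewrite (leq_trans (hU u _)) ?UE ?uC ?leq_subr.
    + have [m1|m1] := leqP (N - #|M|) m.
        by have [i iM <-] := idx_surj m m1 mN; exists i; rewrite ?MC ?iM.
      have [u] := hsurj m m1; rewrite UE => /andP[uC uM] <-.
      by exists u; rewrite // (negbTE uM).
    + case: ifPn => uM; case: ifPn => vM.
      * by apply: contraTneq uv => /idx_inj -> //; rewrite (link_irr g).
      * by rewrite gtn_eqF // (leq_trans (hU v _)) ?UE ?vC // leq_addr.
      * by rewrite ltn_eqF // (leq_trans (hU u _)) ?UE ?uC // leq_addr.
      * by apply: hg; rewrite ?UE ?uC ?vC.
  move=> u uC; case: (boolP (u \in M)) => uM; first by exists u0; rewrite ?gMU.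
  by exists i0; rewrite ?MC // gUM // UE uC.
have M2 : 1 < #|M| by lia.
have [i1 i1M i10] : exists2 i, i \in M & i != i0.
  move: M2; rewrite (cardsD1 i0) i0M ltnS => /card_gt0P[i]; rewrite !inE => /andP[ii0 iM].
  by exists i.
have otherM m : exists2 i, i \in M & idx i != m.
  have [E|] := eqVneq (idx i0) m; last by exists i0.
  by exists i1; rewrite // -E; apply: contra_neq i10; apply: idx_inj.
have [fq fsurj fg] := fcol.
(* A node of [U] of color [f u] has level [(f u).+1], leaving 0 as a mark for the levels that reach
   the numbers of the centers. Centers never carry the mark, since [#|M| < N]. *)
pose c u m := if u \in M then m == idx u
              else (m == (f u).+1) || (m == 0) && (N - #|M| <= (f u).+1).
have cM i m : i \in M -> c i m = (m == idx i) by rewrite /c => ->.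
have cU u m : u \in U -> c u m = (m == (f u).+1) || (m == 0) && (N - #|M| <= (f u).+1).
  by rewrite UE /c => /andP[_ /negbTE ->].
have idx_gt0 i : 0 < idx i by rewrite /idx; lia.
have UC u : u \in U -> u \in C by rewrite UE => /andP[].
have CP u : u \in C -> u \in M \/ u \in U by move=> uC; rewrite UE uC; case: (u \in M); [left|right].
have fN u : u \in U -> (f u).+1 < N.
  by move=> uU; apply: leq_ltn_trans lN; apply: leq_trans (fq u uU) ql.
have N2 : 2 < N by apply: leq_ltn_trans MN.
have level m : 0 < m -> m <= q -> exists2 u, u \in U & (f u).+1 = m.
  by case: m => // m _ /fsurj[u uU <-]; exists u.
have cO m m' : m < N -> m' < N -> m != m' -> exists u, [/\ u \in C, c u m & ~~ c u m'].
  move=> mN m'N mm'; have [m0|m0] := posnP m.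
    (* Since [N < #|M| + q], the levels [N - #|M|] and its successor both occur in [U] and carry the
       mark; [d] is one that differs from [m']. *)
    have [d [d1 dq dm']] : exists d, [/\ N - #|M| <= d, 0 < d <= q & d != m'].
      have [E|E] := eqVneq m' (N - #|M|).
        by exists (N - #|M|).+1; split; lia.
      by exists (N - #|M|); split; lia.
    have [d0 dq'] := andP dq; have [u uU fu] := level d d0 dq'.
    exists u; rewrite !cU // UC // fu m0 d1 orbT eq_sym (negbTE dm'); split=> //.
    by rewrite m0 in mm'; rewrite eq_sym (negbTE mm').
  have [m1|m1] := leqP (N - #|M|) m.
    have [i iM im] := idx_surj m m1 mN.
    by exists i; rewrite !cM // im MC ?eqxx // eq_sym.
  have [u uU fu] := level m m0 (ltac:(lia)).
  exists u; rewrite !cU // UC // fu eqxx; split=> //.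
  by rewrite eq_sym (negbTE mm') /= leqNgt m1 andbF.
exists (extension g C c).
  by apply: extension_is_extension => //; apply: leq_ltn_trans MN.
apply: extension_domination_free => // [u v uC vC uv|u uC|u uC m].
- case: (CP u uC) (CP v vC) => uX [vX|vX].
  + left; exists (idx u); rewrite !cM // idxN // eqxx; split=> //.
    by apply: contraTneq uv => /idx_inj -> //; rewrite (link_irr g).
  (* If the number of the center [u] is the level of [v], no outside link separates them, so a node
     of [U] not linked to [v] is used. *)
  + have [w [wU wv vw]] := constellation_nonadjacent CM vX.
    by right; exists w; rewrite UC // gMU.
  + left; have [vu|vu] := eqVneq (f u).+1 (idx v).
      exists 0; rewrite cU // cM // [0 == idx v]ltn_eqF // vu leq_addr orbT; split=> //.
      exact: leq_trans N2.
    exists (f u).+1; rewrite cU // cM // eqxx; split=> //.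
    exact: fN.
  + left; exists (f u).+1; rewrite !cU // eqxx /= eqSS orbF fg //; split=> //.
    exact: fN.
- case: (CP u uC) => uX.
    by exists 0; [exact: leq_trans N2|rewrite cM // ltn_eqF].
  (* Level 1 misses the number 2 and higher levels miss 1; both numbers are below [N] by [N2]. *)
  have [fu|fu] := eqVneq (f u) 0; first by exists 2; rewrite // cU // fu.
  by exists 1; [exact: leq_trans N2|rewrite cU // eqSS orbF eq_sym].
- move=> cum; have [i iM im] := otherM m; exists i; rewrite MC // cM // [m == _]eq_sym im; split=> //.
  case: (CP u uC) => uX; last by rewrite gUM ?orbT.
  by have [//|iu] := eqVneq i u; rewrite gM // MC.
Qed.

Local Close Scope nat_scope.

Theorem proposition3 (R : realType) (n : nat) (Msg : countType)
    (Msg_infinite : infinite_set [set: Msg]%classic)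
    (x y : Msg) (xy : x != y)
    (lam0 : state -> R) (lam0X : 0 < lam0 stX) (lam0Y : 0 < lam0 stY)
    (lam0_sum1 : \sum_(w : state) lam0 w = 1)
    (k : nat) (k_ge : ((n + 1) %/ 2 <= k)%N) (k_le : (k <= n)%N)
    (lam0_small : lam0 stX < k%:R / (n + k)%:R)
    (g : network n) (C M : {set 'I_n}) (l : nat)
    (C_component : is_component g C)
    (C_constellation : is_constellation g C M)
    (C_depth : constellation_depth g C M l)
    (l_ge1 : (1 <= l)%N)
    (C_gt_k : (k < #|C|)%N)
    (outside : ((maxn l #|M|).+1 <= #|~: C|)%N) :
  exists gp : network n,
    [/\ is_extension g gp,
        net_value x y lam0 k g < net_value x y lam0 k gp
      & net_value x y lam0 k gp = empty_value n x y lam0 k].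
Proof.
have CO : (#|C| + #|~: C| = n)%N by rewrite cardsC card_ord.
have k_gt0 : (0 < k)%N by lia.
have [gp g_gp gp_free] : exists2 gp, is_extension g gp & domination_free gp.
  (* [C] holds more than half of the receivers, because [k] is at least the integer part of (n + 1)
     / 2; hence its complement is no larger. *)
  by apply: domination_free_extension_exists C_constellation C_depth outside _ => //; lia.
have value := net_value_domination_free Msg_infinite xy lam0X lam0Y lam0_sum1 k_gt0 k_le lam0_small.
exists gp; split=> //.
  rewrite (value gp gp_free).
  have [/set0Pn[c cM] /properP[/subsetP/(_ c cM) cC _] gM _] := C_constellation.
  apply: (net_value_center_lt Msg_infinite xy lam0X lam0Y lam0_sum1 k_gt0 k_le lam0_small
            C_gt_k (c := c)) => w wC.
  apply/subsetP => j; rewrite !inE => wj.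
  have [->|jc] := eqVneq j c; first by rewrite orbT.
  have jC : j \in C by case/orP: wj => [/(component_link C_component wC)//|/eqP ->].
  by rewrite gM.
by rewrite /empty_value !value //; apply: empty_network_domination_free.
Qed.
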